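(* For every integer $k\ge1$, the universal network of order $k$ is universally balancing: for every capacity function $c:I\uplus O\to[0,1]$ there is a steady-state $(t,F)$ and $\alpha,\beta\in\mathbb{R}_{\ge0}$ such that (i) for each input $i$, $t(\delta^+(i))=\min\{c(i),\alpha\}$; (ii) for each output $o$, $t(\delta^-(o))=\min\{c(o),\beta\}$; (iii) the total throughput $t(\delta^+(I))$ equals $\min\{c(I),c(O)\}$, where $c(I)=\sum_{i\in I}c(i)$, $c(O)=\sum_{o\in O}c(o)$.
   Context: A splitter network is a finite directed graph $G$ with arc set $E$ whose vertex set is partitioned as $I\uplus S\uplus O$, where each input has out-degree $1$ and in-degree $0$, each output has in-degree $1$ and out-degree $0$, and each splitter has in-degree $2$ and out-degree $2$; by convention a vertex with in-degree $1$ and out-degree $2$ (resp. in-degree $2$ and out-degree $1$) is also a splitter, implicitly completed by a dummy input (resp. output) of capacity $0$ with an arc to (resp. from) it, dummy terminals not being counted in $I$, $O$. $\delta^+(v),\delta^-(v)$ denote outgoing/incoming arcs, $t(A)=\sum_{e\in A}t(e)$. A steady-state for $(G,c)$ is a pair $(t,F)$ with $t:E\to[0,1]$ and $F\subseteq E$ (fluid arcs; $E\setminus F$ saturated) such that: (R3) for each input $i$ with $\delta^+(i)=\{e\}$, $t(e)\le c(i)$, and if $e\in F$ then $t(e)=c(i)$; (R4) for each output $o$ with $\delta^-(o)=\{e\}$, $t(e)\le c(o)$, and if $e\notin F$ then $t(e)=c(o)$; (R5) for each splitter $s$, $t(\delta^-(s))=t(\delta^+(s))$; (R6) for each splitter $s$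 with $\delta^-(s)=\{e_1,e_2\}$ and $e_1\notin F$, $t(e_1)\ge t(e_2)$; (R7) for each splitter $s$ with $\delta^+(s)=\{e_1,e_2\}$ and $e_1\in F$, $t(e_1)\ge t(e_2)$; (R8) for arcs $uv\in E\setminus F$, $vw\in F$, $t(uv)=1$ or $t(vw)=1$. The Beneš network of order $m$ has splitters $s_{(l,j)}$, $l\in\{0,\dots,2m-2\}$, $j\in\{0,\dots,2^{m-1}-1\}$, and, for each $l\in\{0,\dots,2m-3\}$ and $j$, arcs $s_{(l,j)}s_{(l+1,j)}$ and $s_{(l,j)}s_{(l+1,j\oplus2^{l'})}$ with $l'=\max\{m-2-l,l-m+1\}$ ($\oplus$ = bitwise xor). The half-universal network of order $k$ consists of the splitters $s_{(l,j)}$, $l\in\{0,\dots,2k\}$, $j\in\{0,\dots,2^k-1\}$, of the Beneš network of order $k+1$ with all arcs among them, inputs $i_j$, outputs $o_j$ ($j\in\{0,\dots,2^k-1\}$), and arcs $i_js_{(0,j)}$, $s_{(2k,j)}o_j$, $s_{(2k,j)}s_{(0,j)}$. The universal network of order $k$ is obtained from two disjoint copies of the half-universal network of order $k$ by identifying, for each $j$, the input $i_j$ of the first copy with the input $i_j$ of the second copy and likewise for the outputs $o_j$ (these identified vertices become splitters), and adding $2^k$ new input nodes and $2^k$ new output nodes, each new input having one arc to a distinct identified input vertex and each new output having one arc from a distinct identified output vertex. *)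

(* Defs.v *)
From Stdlib Require PeanoNat.
From mathcomp Require Import all_boot all_order all_algebra.
From mathcomp Require Import reals zify.

Set Implicit Arguments.
Unset Strict Implicit.
Unset Printing Implicit Defensive.

(* A finite directed graph (arcs are a type of their own, with source and     *)
(* target maps) whose vertex set is the disjoint sum of three given types.    *)
Record network := Network {
  inputs : finType;
  splitters : finType;
  outputs : finType;
  arcs : finType;
  src : arcs -> inputs + splitters + outputs;
  tgt : arcs -> inputs + splitters + outputs
}.

Definition vertex (N : network) : Type := (inputs N + splitters N + outputs N)%type.

Definition inp (N : network) (i : inputs N) : vertex N := inl (inl i).
Definition spl (N : network) (s : splitters N) : vertex N := inl (inr s).
Definition out (N : network) (o : outputs N) : vertex N := inr o.

Definition delta_out (N : network) (v : vertex N) : {set arcs N} :=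
  [set e | src e == v].
Definition delta_in (N : network) (v : vertex N) : {set arcs N} :=
  [set e | tgt e == v].

Definition terminal_degrees (N : network) : Prop :=
  (forall i : inputs N, #|delta_in (inp i)| = 0 /\ #|delta_out (inp i)| = 1) /\
  (forall o : outputs N, #|delta_in (out o)| = 1 /\ #|delta_out (out o)| = 0).

Definition splitter_degrees (N : network) : Prop :=
  forall s : splitters N,
    (#|delta_in (spl s)|, #|delta_out (spl s)|) \in [:: (2, 2); (1, 2); (2, 1)].

(* Splitter networks, where a splitter may lack one incoming or one outgoing  *)
(* arc; see [complete] for the implicit dummy terminals.                      *)
Record splitter_network := SplitterNetwork {
  net :> network;
  net_terminal_degrees : terminal_degrees net;
  net_splitter_degrees : splitter_degrees net
}.

Lemma card_pair (T : finType) (x y : T) : x <> y -> #|[set x; y]| = 2.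
Proof. by move=> /eqP xy; rewrite cards2 xy. Qed.

Section Completion.
Variable N : network.

Definition in_deficient : finType := {s : splitters N | #|delta_in (spl s)| == 1}.
Definition out_deficient : finType := {s : splitters N | #|delta_out (spl s)| == 1}.

Definition complete_vertex (v : vertex N) :
    (inputs N + in_deficient) + splitters N + (outputs N + out_deficient) :=
  match v with
  | inl (inl i) => inl (inl (inl i))
  | inl (inr s) => inl (inr s)
  | inr o => inr (inl o)
  end.

(* One dummy input (resp. output), with its arc, for each splitter of         *)
(* in-degree (resp. out-degree) 1.                                            *)
Definition complete : network :=
  @Network
    (inputs N + in_deficient)%type (splitters N) (outputs N + out_deficient)%type
    (arcs N + in_deficient + out_deficient)%type
    (fun e => match e with
              | inl (inl a) => complete_vertex (src a)
              | inl (inr d) => inl (inl (inr d))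
              | inr d => inl (inr (val d))
              end)
    (fun e => match e with
              | inl (inl a) => complete_vertex (tgt a)
              | inl (inr d) => inl (inr (val d))
              | inr d => inr (inr d)
              end).

Definition complete_capacity (R : realType) (c : inputs N + outputs N -> R)
    (v : inputs complete + outputs complete) : R :=
  match v with
  | inl (inl i) => c (inl i)
  | inr (inl o) => c (inr o)
  | inl (inr _) | inr (inr _) => 0%R
  end.

Lemma complete_terminal_degrees :
  terminal_degrees N -> terminal_degrees complete.
Proof.
have injE : injective (fun a : arcs N => inl (inl a) : arcs complete) by move=> a a' [].
have vK : injective complete_vertex.
  by move=> [[?|?]|?] [[?|?]|?] //= E; congruence.
have oldO (v : vertex N) : (forall s, v <> spl s) ->
    @delta_out complete (complete_vertex v) = [set inl (inl a) | a in delta_out v].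
  move=> vs; apply/setP=> -[[a|d]|d]; rewrite !inE.
  - by rewrite mem_imset // inE (inj_eq vK).
  - by case: v vs => [[?|?]|?] _; apply/esym/negbTE/negP => /imsetP[].
  - case: v vs => [[?|s]|?] vs; try by case: (vs s).
      by apply/esym/negbTE/negP => /imsetP[].
    by apply/esym/negbTE/negP => /imsetP[].
have oldI (v : vertex N) : (forall s, v <> spl s) ->
    @delta_in complete (complete_vertex v) = [set inl (inl a) | a in delta_in v].
  move=> vs; apply/setP=> -[[a|d]|d]; rewrite !inE.
  - by rewrite mem_imset // inE (inj_eq vK).
  - case: v vs => [[?|s]|?] vs; try by case: (vs s).
      by apply/esym/negbTE/negP => /imsetP[].
    by apply/esym/negbTE/negP => /imsetP[].
  - by case: v vs => [[?|?]|?] _; apply/esym/negbTE/negP => /imsetP[].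
move=> [degI degO]; split=> [[i|d]|[o|d]].
- have ns s : inp i <> spl s by [].
  have EI : delta_in (@inp complete (inl i)) = _ := oldI (inp i) ns.
  have EO : delta_out (@inp complete (inl i)) = _ := oldO (inp i) ns.
  rewrite EI EO !card_imset //; exact: degI.
- split; last apply/eqP/cards1P; first apply/eqP; rewrite ?cards_eq0.
    by apply/eqP/setP=> -[[a|d']|d']; rewrite !inE //=; case: (tgt a) => [[?|?]|?].
  exists (inl (inr d)); apply/setP=> -[[a|d']|d']; rewrite !inE //=.
  by case: (src a) => [[?|?]|?].
- have ns s : out o <> spl s by [].
  have EI : delta_in (@out complete (inl o)) = _ := oldI (out o) ns.
  have EO : delta_out (@out complete (inl o)) = _ := oldO (out o) ns.
  rewrite EI EO !card_imset //; exact: degO.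
- split; first apply/eqP/cards1P; last apply/eqP; rewrite ?cards_eq0.
    exists (inr d); apply/setP=> -[[a|d']|d']; rewrite !inE //=.
    by case: (tgt a) => [[?|?]|?].
  by apply/eqP/setP=> -[[a|d']|d']; rewrite !inE //=; case: (src a) => [[?|?]|?].
Qed.

Lemma complete_splitter_degrees : splitter_degrees N ->
  forall s : splitters complete,
    #|delta_in (spl s)| = 2 /\ #|delta_out (spl s)| = 2.
Proof.
have injE : injective (fun a : arcs N => inl (inl a) : arcs complete) by move=> a a' [].
have inE' s : #|delta_in (@spl complete s)| =
    #|delta_in (@spl N s)| + (#|delta_in (@spl N s)| == 1).
  have [d1|d1] := boolP (#|delta_in (@spl N s)| == 1).
    have -> : delta_in (@spl complete s) =
        inl (inr (Sub s d1)) |: [set inl (inl a) | a in delta_in (@spl N s)].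
      apply/setP=> -[[a|d]|d]; rewrite !inE /=.
      + by rewrite mem_imset // inE; case: (tgt a) => [[?|?]|?].
      + rewrite [X in _ || X](introF imsetP _) ?orbF; last by move=> [].
        apply/eqP/eqP => [[E]|[->] //]; congr (inl (inr _)).
        exact: val_inj.
      + by apply/esym/negbTE/negP => /imsetP[].
    by rewrite cardsU1 card_imset // addnC [_ \in _](introF imsetP _) // => -[].
  have -> : delta_in (@spl complete s) =
      [set inl (inl a) | a in delta_in (@spl N s)].
    apply/setP=> -[[a|d]|d]; rewrite !inE /=.
    + by rewrite mem_imset // inE; case: (tgt a) => [[?|?]|?].
    + rewrite [RHS](introF imsetP _); last by move=> [].
      by apply/negP => /eqP[E]; move: d1; rewrite -E (valP d).
    + by apply/esym/negbTE/negP => /imsetP[].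
  by rewrite card_imset // addn0.
have outE' s : #|delta_out (@spl complete s)| =
    #|delta_out (@spl N s)| + (#|delta_out (@spl N s)| == 1).
  have [d1|d1] := boolP (#|delta_out (@spl N s)| == 1).
    have -> : delta_out (@spl complete s) =
        inr (Sub s d1) |: [set inl (inl a) | a in delta_out (@spl N s)].
      apply/setP=> -[[a|d]|d]; rewrite !inE /=.
      + by rewrite mem_imset // inE; case: (src a) => [[?|?]|?].
      + by apply/esym/negbTE/negP => /imsetP[].
      + rewrite [X in _ || X](introF imsetP _) ?orbF; last by move=> [].
        apply/eqP/eqP => [[E]|[->] //]; congr (inr _).
        exact: val_inj.
    by rewrite cardsU1 card_imset // addnC [_ \in _](introF imsetP _) // => -[].
  have -> : delta_out (@spl complete s) =
      [set inl (inl a) | a in delta_out (@spl N s)].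
    apply/setP=> -[[a|d]|d]; rewrite !inE /=.
    + by rewrite mem_imset // inE; case: (src a) => [[?|?]|?].
    + by apply/esym/negbTE/negP => /imsetP[].
    + rewrite [RHS](introF imsetP _); last by move=> [].
      by apply/negP => /eqP[E]; move: d1; rewrite -E (valP d).
  by rewrite card_imset // addn0.
move=> deg s; rewrite inE' outE'; have := deg s; rewrite !inE.
by case/or3P => /eqP[-> ->].
Qed.

End Completion.

Local Open Scope ring_scope.

Definition flow (R : realType) (N : network) (t : arcs N -> R) (A : {set arcs N}) : R :=
  \sum_(e in A) t e.

(* F is the set of fluid arcs, its complement the set of saturated arcs.      *)
Record steady_state (R : realType) (N : network) (c : inputs N + outputs N -> R)
    (t : arcs N -> R) (F : {set arcs N}) : Prop := SteadyState {
  ss_range : forall e, 0 <= t e <= 1;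
  ss_input : forall (i : inputs N) (e : arcs N), delta_out (inp i) = [set e] ->
    t e <= c (inl i) /\ (e \in F -> t e = c (inl i));
  ss_output : forall (o : outputs N) (e : arcs N), delta_in (out o) = [set e] ->
    t e <= c (inr o) /\ (e \notin F -> t e = c (inr o));
  ss_conservation : forall s : splitters N,
    flow t (delta_in (spl s)) = flow t (delta_out (spl s));
  ss_in_fair : forall (s : splitters N) (e1 e2 : arcs N),
    delta_in (spl s) = [set e1; e2] -> e1 \notin F -> t e2 <= t e1;
  ss_out_fair : forall (s : splitters N) (e1 e2 : arcs N),
    delta_out (spl s) = [set e1; e2] -> e1 \in F -> t e2 <= t e1;
  ss_maximal : forall e f : arcs N, tgt e = src f -> e \notin F -> f \in F ->
    t e = 1 \/ t f = 1
}.

Definition universally_balancing (R : realType) (N : splitter_network) : Prop :=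
  forall c : inputs N + outputs N -> R, (forall v, 0 <= c v <= 1) ->
  exists (t : arcs (complete N) -> R) (F : {set arcs (complete N)}) (alpha beta : R),
    [/\ steady_state (complete_capacity c) t F,
        0 <= alpha /\ 0 <= beta,
        forall i : inputs N,
          flow t (@delta_out (complete N) (complete_vertex (inp i)))
          = Num.min (c (inl i)) alpha,
        forall o : outputs N,
          flow t (@delta_in (complete N) (complete_vertex (out o)))
          = Num.min (c (inr o)) beta
      & flow t (\bigcup_(i : inputs N)
                  @delta_out (complete N) (complete_vertex (inp i)))
        = Num.min (\sum_(i : inputs N) c (inl i)) (\sum_(o : outputs N) c (inr o))].

Local Close Scope ring_scope.

Lemma lxor_ltn n a b : a < 2 ^ n -> b < 2 ^ n -> Nat.lxor a b < 2 ^ n.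
Proof.
have E x : 0 < x -> (x < 2 ^ n) = (Nat.log2 x < n).
  move=> x0; have -> : 2 ^ n = Nat.pow 2 n.
    by elim: n => //= n <-; rewrite expnS; lia.
  have /= H := PeanoNat.Nat.log2_lt_pow2 x n ltac:(lia).
  by apply/idP/idP => /ltP/H/ltP.
have [->|a0] := posnP a; first by rewrite PeanoNat.Nat.lxor_0_l.
have [->|b0] := posnP b; first by rewrite PeanoNat.Nat.lxor_0_r.
have [->|c0] := posnP (Nat.lxor a b); first by rewrite expn_gt0.
rewrite !E //; have := PeanoNat.Nat.log2_lxor a b; lia.
Qed.

Definition xor_ord n (a b : 'I_(2 ^ n)) : 'I_(2 ^ n) :=
  Ordinal (lxor_ltn (ltn_ord a) (ltn_ord b)).

Lemma xor_ordK n (b : 'I_(2 ^ n)) : involutive (fun a => xor_ord a b).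
Proof.
move=> a; apply: val_inj => /=.
by rewrite PeanoNat.Nat.lxor_assoc PeanoNat.Nat.lxor_nilpotent PeanoNat.Nat.lxor_0_r.
Qed.

Section Benes.
Variable m : nat.

Definition benes_splitter : finType := ('I_(m.*2.-1) * 'I_(2 ^ m.-1))%type.

(* The arc (l, j, false) goes from (l, j) to (l + 1, j), and (l, j, true) to  *)
(* (l + 1, j xor 2 ^ l') with l' = max(m - 2 - l, l - m + 1).                 *)
Definition benes_arc : finType := ('I_(m.*2.-2) * 'I_(2 ^ m.-1) * bool)%type.

Lemma benes_src_subproof (l : 'I_(m.*2.-2)) : l < m.*2.-1.
Proof. by have := ltn_ord l; lia. Qed.

Lemma benes_tgt_subproof (l : 'I_(m.*2.-2)) : l.+1 < m.*2.-1.
Proof. by have := ltn_ord l; lia. Qed.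

(* Both subtractions are truncated, which does not change the maximum.        *)
Definition benes_bit (l : nat) : nat := maxn (m - 2 - l) (l.+1 - m).

Lemma benes_bit_subproof (l : 'I_(m.*2.-2)) : 2 ^ benes_bit l < 2 ^ m.-1.
Proof. by rewrite ltn_exp2l // /benes_bit; have := ltn_ord l; lia. Qed.

Definition benes_src (a : benes_arc) : benes_splitter :=
  let: (l, j, _) := a in (Ordinal (benes_src_subproof l), j).

Definition benes_tgt (a : benes_arc) : benes_splitter :=
  let: (l, j, cross) := a in
  (Ordinal (benes_tgt_subproof l),
   if cross then xor_ord j (Ordinal (benes_bit_subproof l)) else j).

End Benes.

Section HalfUniversal.
Variable k : nat.

Definition first_level (j : 'I_(2 ^ k)) : benes_splitter k.+1 := (ord0, j).
Definition last_level (j : 'I_(2 ^ k)) : benes_splitter k.+1 := (ord_max, j).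

(* Arcs: those of the Benes network of order k + 1, then for each j the arcs  *)
(* i_j s_(0,j), s_(2k,j) o_j and s_(2k,j) s_(0,j).                            *)
Definition half_universal_net : network :=
  @Network
    'I_(2 ^ k) (benes_splitter k.+1) 'I_(2 ^ k)
    (benes_arc k.+1 + 'I_(2 ^ k) + 'I_(2 ^ k) + 'I_(2 ^ k))%type
    (fun e => match e with
              | inl (inl (inl a)) => inl (inr (benes_src a))
              | inl (inl (inr j)) => inl (inl j)
              | inl (inr j) | inr j => inl (inr (last_level j))
              end)
    (fun e => match e with
              | inl (inl (inl a)) => inl (inr (benes_tgt a))
              | inl (inr j) => inr j
              | inl (inl (inr j)) | inr j => inl (inr (first_level j))
              end).

Lemma half_universal_terminal_degrees : terminal_degrees half_universal_net.
Proof.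
split=> j; split; try by apply/eqP; rewrite cards_eq0; apply/eqP/setP=> -[[[a|i]|i]|i];
  rewrite !inE.
- have -> : delta_out (@inp half_universal_net j) = [set inl (inl (inr j))].
    by apply/setP=> -[[[a|i]|i]|i]; rewrite !inE.
  exact: cards1.
- have -> : delta_in (@out half_universal_net j) = [set inl (inr j)].
    by apply/setP=> -[[[a|i]|i]|i]; rewrite !inE.
  exact: cards1.
Qed.

Lemma half_universal_out_degree (s : benes_splitter k.+1) :
  #|delta_out (@spl half_universal_net s)| = 2.
Proof.
case: s => l j; have [lk|lk] := ltnP l k.*2.
  have -> : delta_out (@spl half_universal_net (l, j)) =
    [set inl (inl (inl (Ordinal lk, j, true))); inl (inl (inl (Ordinal lk, j, false)))].
    apply/setP=> -[[[[[l' i] b]|i]|i]|i]; rewrite !inE //=.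
    - apply/idP/idP => [/eqP[El ->]|].
        have -> : l' = Ordinal lk by apply: val_inj; rewrite /= -[RHS](congr1 val El).
        by case: b; rewrite eqxx ?orbT.
      by case/orP => /eqP[-> -> _]; apply/eqP; congr (inl (inr (_, _))); apply: val_inj.
    - by apply/negP => /eqP[El _]; move: lk; rewrite -El /= ltnn.
    - by apply/negP => /eqP[El _]; move: lk; rewrite -El /= ltnn.
  by apply: card_pair => -[].
have El : l = ord_max by apply/val_inj/eqP; rewrite /= eqn_leq lk -ltnS ltn_ord.
have -> : delta_out (@spl half_universal_net (l, j)) = [set inl (inr j); inr j].
  apply/setP=> -[[[[[l' i] b]|i]|i]|i]; rewrite !inE //= ?orbF ?El.
  - by apply/negP => /eqP[E _]; have := ltn_ord l'; rewrite E /= ltnn.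
  - by apply/eqP/eqP => [[->]|[->]].
  - by apply/eqP/eqP => [[->]|[->]].
by apply: card_pair => -[].
Qed.

Lemma half_universal_in_degree (s : benes_splitter k.+1) :
  #|delta_in (@spl half_universal_net s)| = 2.
Proof.
case: s => l j; have [l0|l0] := posnP l.
  have El : l = ord0 by apply: val_inj.
  have -> : delta_in (@spl half_universal_net (l, j)) = [set inl (inl (inr j)); inr j].
    apply/setP=> -[[[[[l' i] b]|i]|i]|i]; rewrite !inE //= ?orbF ?El.
    - by apply/negP => /eqP[].
    - by apply/eqP/eqP => [[->]|[->]].
    - by apply/eqP/eqP => [[->]|[->]].
  by apply: card_pair => -[].
have lk : l.-1 < k.*2 by rewrite -ltnS prednK // ltn_ord.
pose l1 : 'I_(k.+1.*2.-2) := Ordinal lk.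
have -> : delta_in (@spl half_universal_net (l, j)) =
    [set inl (inl (inl (l1, xor_ord j (Ordinal (benes_bit_subproof l1)), true)));
         inl (inl (inl (l1, j, false)))].
  apply/setP=> -[[[[[l' i] b]|i]|i]|i]; rewrite !inE //=.
  - apply/idP/idP => [/eqP[El]|].
      have -> : l' = l1 by apply: val_inj; rewrite /= -(congr1 val El).
      by case: b => <-; rewrite ?xor_ordK eqxx ?orbT.
    by case/orP => /eqP[-> -> ->]; apply/eqP; congr (inl (inr (_, _)));
      rewrite ?xor_ordK //; apply: val_inj; rewrite /= prednK.
  - by apply/negP => /eqP[El _]; move: l0; rewrite -El.
  - by apply/negP => /eqP[El _]; move: l0; rewrite -El.
by apply: card_pair => -[].
Qed.

Lemma half_universal_splitter_degrees : splitter_degrees half_universal_net.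
Proof.
by move=> s; rewrite half_universal_in_degree half_universal_out_degree.
Qed.

Definition half_universal : splitter_network :=
  SplitterNetwork half_universal_terminal_degrees half_universal_splitter_degrees.

End HalfUniversal.

Section Doubling.
Variable H : splitter_network.

(* Splitters of the doubled network: the inputs and the outputs of H, each    *)
(* shared by the two copies, and two copies of the splitters of H.            *)
Definition doubled_splitter : finType :=
  (inputs H + outputs H + bool * splitters H)%type.

Definition doubled_vertex (copy : bool) (v : vertex H) :
    inputs H + doubled_splitter + outputs H :=
  inl (inr match v with
           | inl (inl i) => inl (inl i)
           | inl (inr s) => inr (copy, s)
           | inr o => inl (inr o)
           end).

(* Arcs: those of the two copies of H, then one from the new input i to the   *)
(* shared vertex i, and one from the shared vertex o to the new output o.     *)
Definition doubled_net : network :=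
  @Network
    (inputs H) doubled_splitter (outputs H)
    (bool * arcs H + inputs H + outputs H)%type
    (fun e => match e with
              | inl (inl (copy, a)) => doubled_vertex copy (src a)
              | inl (inr i) => inl (inl i)
              | inr o => inl (inr (inl (inr o)))
              end)
    (fun e => match e with
              | inl (inl (copy, a)) => doubled_vertex copy (tgt a)
              | inl (inr i) => inl (inr (inl (inl i)))
              | inr o => inr o
              end).

Lemma doubled_terminal_degrees : terminal_degrees doubled_net.
Proof.
split=> j; split; try by apply/eqP; rewrite cards_eq0; apply/eqP/setP=> -[[[b a]|i]|i];
  rewrite !inE.
- have -> : delta_out (@inp doubled_net j) = [set inl (inr j)].
    by apply/setP=> -[[[b a]|i]|i]; rewrite !inE.
  exact: cards1.
- have -> : delta_in (@out doubled_net j) = [set inr j].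
    by apply/setP=> -[[[b a]|i]|i]; rewrite !inE.
  exact: cards1.
Qed.

Lemma doubled_splitter_degrees : splitter_degrees doubled_net.
Proof.
have [degI degO] := net_terminal_degrees H.
case=> [[i|o]|[b s]].
- have -> : delta_in (@spl doubled_net (inl (inl i))) = [set inl (inr i)].
    apply/setP=> -[[[b a]|i']|o]; rewrite !inE //=.
    apply/negP=> /eqP[]; case Ea: (tgt a) => [[i'|]|] // [Ei].
    have /eqP := (degI i').1; rewrite cards_eq0 => /eqP/setP/(_ a).
    by rewrite !inE Ea eqxx.
  have /eqP/cards1P[a0 Ea0] := (degI i).2.
  have -> : delta_out (@spl doubled_net (inl (inl i))) =
      [set inl (inl (true, a0)); inl (inl (false, a0))].
    apply/setP=> -[[[b a]|i']|o]; rewrite !inE //=.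
    transitivity (a == a0).
      have := in_set1 a a0; rewrite -Ea0 inE => <-.
      by case: (src a) => [[?|?]|?].
    by rewrite /eq_op /= /eq_op /=; case: b; rewrite //= orbF.
  by rewrite cards1 card_pair.
- have -> : delta_out (@spl doubled_net (inl (inr o))) = [set inr o].
    apply/setP=> -[[[b a]|i']|o']; rewrite !inE //=.
    apply/negP=> /eqP[]; case Ea: (src a) => [[|]|o'] // [Ei].
    have /eqP := (degO o').2; rewrite cards_eq0 => /eqP/setP/(_ a).
    by rewrite !inE Ea eqxx.
  have /eqP/cards1P[a0 Ea0] := (degO o).1.
  have -> : delta_in (@spl doubled_net (inl (inr o))) =
      [set inl (inl (true, a0)); inl (inl (false, a0))].
    apply/setP=> -[[[b a]|i']|o']; rewrite !inE //=.
    transitivity (a == a0).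
      have := in_set1 a a0; rewrite -Ea0 inE => <-.
      by case: (tgt a) => [[?|?]|?].
    by rewrite /eq_op /= /eq_op /=; case: b; rewrite //= orbF.
  by rewrite cards1 card_pair.
have inj : injective (fun a : arcs H => inl (inl (b, a)) : arcs doubled_net).
  by move=> a a' [].
have -> : delta_in (@spl doubled_net (inr (b, s))) =
    [set inl (inl (b, a)) | a in delta_in (spl s)].
  apply/setP=> -[[[b' a]|i']|o']; rewrite !inE; last first.
  - by apply/esym/negP => /imsetP[].
  - by apply/esym/negP => /imsetP[].
  apply/eqP/imsetP => [[]|[a' + [-> ->]]].
    case Ea: (tgt a) => [[|s']|] // [-> Es].
    by exists a; rewrite // inE Ea Es.
  by rewrite inE => /eqP /= ->.
have -> : delta_out (@spl doubled_net (inr (b, s))) =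
    [set inl (inl (b, a)) | a in delta_out (spl s)].
  apply/setP=> -[[[b' a]|i']|o']; rewrite !inE; last first.
  - by apply/esym/negP => /imsetP[].
  - by apply/esym/negP => /imsetP[].
  apply/eqP/imsetP => [[]|[a' + [-> ->]]].
    case Ea: (src a) => [[|s']|] // [-> Es].
    by exists a; rewrite // inE Ea Es.
  by rewrite inE => /eqP /= ->.
by rewrite !card_imset //; exact: net_splitter_degrees.
Qed.

Definition doubled : splitter_network :=
  SplitterNetwork doubled_terminal_degrees doubled_splitter_degrees.

End Doubling.

Definition universal_network (k : nat) : splitter_network :=
  doubled (half_universal k).

(* Main.v *)
Require Import Defs.
From mathcomp Require Import all_boot all_order all_algebra.
From mathcomp Require Import reals topology normedtype zify ring lra.

(* Reversing all arcs and exchanging fluid and saturated arcs turns steady    *)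
(* states into steady states, and the half-universal network is isomorphic to *)
(* its reversal, so one may assume c(I) <= c(O).  Give each half-universal    *)
(* copy half of every capacity and choose b with sum_o min(c(o)/2, b) equal   *)
(* to c(I)/2.  If each last-level splitter receives 2b, passes min(c(o)/2, b) *)
(* to its output and sends the rest back, the total entering the first level  *)
(* is 2^k * 2b.  With every Benes arc fluid and every splitter sending half   *)
(* of its load along each outgoing arc, level l < k averages the loads over   *)
(* bit k - 1 - l of the column index; after k levels all loads equal 2b, which*)
(* is what was assumed.  Loads never exceed 3/2 since capacities are halved   *)
(* and b <= 1/2, so a Benes arc carries at most 3/4 and a back arc at most 1. *)
(* The only saturated arcs lead to outputs with c(o)/2 < b.                   *)

Set Implicit Arguments.
Unset Strict Implicit.
Unset Printing Implicit Defensive.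

Import Order.TTheory GRing.Theory Num.Theory.
Import numFieldNormedType.Exports.
Local Open Scope ring_scope.

(** Three reductions leave one explicit construction. The dummy arcs of the completion carry 0 and
    satisfy the rules trivially ([complete_steady_state]). A steady state of the half-universal
    network for halved capacities, used in both copies, yields one of the universal network with
    doubled terminal flows ([doubled_steady_state]). Reversal exchanges supply and demand
    ([steady_state_reversal]), so supply may be assumed not to exceed demand.

    In that case every input is emptied, and [water_filling] supplies the cap [b] on outputs. The
    back arcs make the flow self-referential: their values come from an assumed last-level load
    [2b], which the network must reproduce. It does, because mixing preserves the total load and
    makes all columns equal ([load_uniform]), and the choice of [b] makes the mean exactly [2b].
    [half_surplus_steady_state] checks the rules. *)

Section Networks.
Variable R : realType.
Implicit Types N : network.

(** * Flow through explicit arc sets *)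

Lemma flow1 N (t : arcs N -> R) e : flow t [set e] = t e.
Proof. exact: big_set1. Qed.

Lemma big_set_pred (T : finType) (P : pred T) (f : T -> R) :
  \sum_(x | P x) f x = \sum_(x in [set x | P x]) f x.
Proof. by apply: eq_bigl => x; rewrite inE. Qed.

Lemma flow2 N (t : arcs N -> R) (A : {set arcs N}) e1 e2 :
  #|A| = 2 -> e1 \in A -> e2 \in A -> e1 != e2 -> flow t A = t e1 + t e2.
Proof.
move=> A2 Ae1 Ae2 ne; have -> : A = e1 |: [set e2].
  apply/esym/eqP; rewrite eqEcard cards2 ne A2 leqnn andbT.
  by apply/subsetP => e /set2P[] ->.
by rewrite /flow big_setU1 ?inE //= big_set1.
Qed.

Lemma flow_bigcup_delta_out N (t : arcs N -> R) (I : finType) (v : I -> vertex N) :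
  injective v -> flow t (\bigcup_i delta_out (v i)) = \sum_i flow t (delta_out (v i)).
Proof.
move=> vI; rewrite /flow partition_disjoint_bigcup // => i j ij.
rewrite disjoints_subset; apply/subsetP => e; rewrite !inE => /eqP ->.
by rewrite (inj_eq vI).
Qed.

(** * Removing dummy terminals *)

Section Completion.
Variable N : network.

Definition complete_flow (t : arcs N -> R) (e : arcs (complete N)) : R :=
  if e is inl (inl a) then t a else 0.

(* A dummy input never pushes back and a dummy output never accepts anything. *)
Definition complete_fluid (F : {set arcs N}) : {set arcs (complete N)} :=
  [set e | match e with
           | inl (inl a) => a \in F
           | inl (inr _) => true
           | inr _ => false
           end].

Lemma complete_vertex_inj : injective (@complete_vertex N).
Proof. by move=> [[?|?]|?] [[?|?]|?] //= E; congruence. Qed.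

Lemma flow_complete_out t (v : vertex N) :
  flow (complete_flow t) (@delta_out (complete N) (complete_vertex v)) =
  flow t (delta_out v).
Proof.
rewrite /flow !big_sumType /= [X in _ + X + _]big1 // [X in _ + X]big1 // !addr0.
by apply: eq_bigl => e; rewrite !inE /= (inj_eq complete_vertex_inj).
Qed.

Lemma flow_complete_in t (v : vertex N) :
  flow (complete_flow t) (@delta_in (complete N) (complete_vertex v)) =
  flow t (delta_in v).
Proof.
rewrite /flow !big_sumType /= [X in _ + X + _]big1 // [X in _ + X]big1 // !addr0.
by apply: eq_bigl => e; rewrite !inE /= (inj_eq complete_vertex_inj).
Qed.

Lemma complete_out_preim (v : vertex N) (A : {set arcs (complete N)}) :
  @delta_out (complete N) (complete_vertex v) = A ->
  delta_out v = [set a | inl (inl a) \in A].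
Proof.
by move=> <-; apply/setP => a; rewrite !inE /= (inj_eq complete_vertex_inj).
Qed.

Lemma complete_in_preim (v : vertex N) (A : {set arcs (complete N)}) :
  @delta_in (complete N) (complete_vertex v) = A ->
  delta_in v = [set a | inl (inl a) \in A].
Proof.
by move=> <-; apply/setP => a; rewrite !inE /= (inj_eq complete_vertex_inj).
Qed.

(** A dummy arc carries 0, its capacity, so it never exceeds a competing arc. Its status never
    activates a fairness rule, and it never forms a saturated-then-fluid pair. *)
Lemma complete_steady_state c (t : arcs N -> R) F :
  steady_state c t F ->
  steady_state (complete_capacity c) (complete_flow t) (complete_fluid F).
Proof.
case=> tr tI tO tS fI fO tM; split.
- by move=> [[a|d]|d] //=; rewrite lexx ler01.
- move=> [i|d] [[a|d']|d'] E; rewrite ?inE /=.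
  + apply: tI; rewrite (complete_out_preim (v := inp i) E).
    by apply/setP => b; rewrite !inE.
  + by have /setP/(_ (inl (inr d'))) := E; rewrite !inE eqxx.
  + by have /setP/(_ (inr d')) := E; rewrite !inE eqxx.
  + have /setP/(_ (inl (inl a))) := E; rewrite !inE eqxx /=.
    by case: (src a) => [[?|?]|?].
  + by [].
  + by [].
- move=> [o|d] [[a|d']|d'] E; rewrite ?inE /=.
  + apply: tO; rewrite (complete_in_preim (v := out o) E).
    by apply/setP => b; rewrite !inE.
  + by have /setP/(_ (inl (inr d'))) := E; rewrite !inE eqxx.
  + by have /setP/(_ (inr d')) := E; rewrite !inE eqxx.
  + have /setP/(_ (inl (inl a))) := E; rewrite !inE eqxx /=.
    by case: (tgt a) => [[?|?]|?].
  + by [].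
  + by [].
- move=> s; have := flow_complete_in t (@spl N s); rewrite tS -flow_complete_out; exact.
- move=> s [[a1|d1]|d1] e2 E; rewrite !inE //=; last first.
    by have /setP/(_ (inr d1)) := E; rewrite !inE eqxx.
  case: e2 E => [[a2|d2]|d2] E /= F1; try by case/andP: (tr a1).
  apply: (fI s) F1; apply: etrans (complete_in_preim (v := @spl N s) E) _.
  by apply/setP => b; rewrite !inE.
- move=> s [[a1|d1]|d1] e2 E; rewrite !inE //=; last first.
    by have /setP/(_ (inl (inr d1))) := E; rewrite !inE eqxx.
  case: e2 E => [[a2|d2]|d2] E /= F1; try by case/andP: (tr a1).
  apply: (fO s) F1; apply: etrans (complete_out_preim (v := @spl N s) E) _.
  by apply/setP => b; rewrite !inE.
- move=> [[a|d]|d] [[a'|d']|d']; rewrite !inE //=.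
  + by move/complete_vertex_inj; exact: tM.
  + by case: (tgt a) => [[?|?]|?].
  + by case: (src a') => [[?|?]|?].
Qed.

End Completion.

(** * Duality under arc reversal *)

Section Reversal.
Variables (N : network) (rv : vertex N -> vertex N) (ra : arcs N -> arcs N).
Variables (fI : inputs N -> outputs N) (fO : outputs N -> inputs N).
Variable fS : splitters N -> splitters N.
Hypothesis rvK : involutive rv.
Hypothesis raK : involutive ra.
Hypothesis rv_inp : forall i, rv (inp i) = out (fI i).
Hypothesis rv_spl : forall s, rv (@spl N s) = spl (fS s).
Hypothesis rv_out : forall o, rv (out o) = inp (fO o).
Hypothesis src_ra : forall e, src (ra e) = rv (tgt e).
Hypothesis tgt_ra : forall e, tgt (ra e) = rv (src e).

Lemma delta_out_reversal v : delta_out (rv v) = ra @^-1: delta_in v.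
Proof. by apply/setP => e; rewrite !inE tgt_ra -(inv_eq rvK). Qed.

Lemma delta_in_reversal v : delta_in (rv v) = ra @^-1: delta_out v.
Proof. by apply/setP => e; rewrite !inE src_ra -(inv_eq rvK). Qed.

Lemma flow_reversal (t : arcs N -> R) (A : {set arcs N}) :
  flow t (ra @^-1: A) = flow (t \o ra) A.
Proof.
rewrite /flow [LHS](reindex_inj (inv_inj raK)) /=.
by apply: eq_bigl => e; rewrite inE raK.
Qed.

Lemma preim_ra1 e : ra @^-1: [set e] = [set ra e].
Proof. by apply/setP => e'; rewrite !inE (inv_eq raK). Qed.

Lemma preim_ra2 e1 e2 : ra @^-1: [set e1; e2] = [set ra e1; ra e2].
Proof. by apply/setP => e'; rewrite !inE !(inv_eq raK). Qed.

Lemma fIK : cancel fI fO.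
Proof. by move=> i; have := rvK (inp i); rewrite rv_inp rv_out => -[]. Qed.

Lemma fOK : cancel fO fI.
Proof. by move=> o; have := rvK (out o); rewrite rv_out rv_inp => -[]. Qed.

(** Reversal with complementation of [F] exchanges the input and output rules and the two fairness
    rules, and swaps the two alternatives of maximality. *)
Lemma steady_state_reversal c (t : arcs N -> R) F :
  steady_state
    (fun v => match v with inl i => c (inr (fI i)) | inr o => c (inl (fO o)) end) t F ->
  steady_state c (t \o ra) (~: (ra @^-1: F)).
Proof.
case=> tr tI tO tS fI' fO' tM; split.
- by move=> e; exact: tr.
- move=> i e E; rewrite !inE -(fIK i); apply: (tO (fI i)).
  by rewrite -rv_inp delta_in_reversal E preim_ra1.
- move=> o e E; rewrite !inE negbK -(fOK o); apply: (tI (fO o)).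
  by rewrite -rv_out delta_out_reversal E preim_ra1.
- by move=> s; rewrite -!flow_reversal -delta_out_reversal -delta_in_reversal rv_spl tS.
- move=> s e1 e2 E; rewrite !inE negbK; apply: (fO' (fS s)).
  by rewrite -rv_spl delta_out_reversal E preim_ra2.
- move=> s e1 e2 E; rewrite !inE; apply: (fI' (fS s)).
  by rewrite -rv_spl delta_in_reversal E preim_ra2.
- move=> e f ef; rewrite !inE negbK => Fe Ff.
  by apply/or_comm/tM => //; rewrite tgt_ra src_ra ef.
Qed.

End Reversal.

(** * From one copy to the doubled network *)

Section Doubling.
Variable H : splitter_network.
Variables (ai : inputs H -> arcs H) (ao : outputs H -> arcs H).
Hypothesis aiP : forall i, delta_out (inp i) = [set ai i].
Hypothesis aoP : forall o, delta_in (out o) = [set ao o].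

Definition doubled_flow (t : arcs H -> R) (e : arcs (doubled_net H)) : R :=
  match e with
  | inl (inl (_, a)) => t a
  | inl (inr i) => t (ai i) *+ 2
  | inr o => t (ao o) *+ 2
  end.

(** A new terminal arc inherits the status of the old one, so the status does not change across a
    shared vertex and maximality holds there. *)
Definition doubled_fluid (F : {set arcs H}) : {set arcs (doubled_net H)} :=
  [set e | match e with
           | inl (inl (_, a)) => a \in F
           | inl (inr i) => ai i \in F
           | inr o => ao o \in F
           end].

Lemma doubled_delta_out_inp i :
  @delta_out (doubled_net H) (@inp (doubled_net H) i) = [set inl (inr i)].
Proof. by apply/setP=> -[[[b a]|i']|o]; rewrite !inE. Qed.

Lemma doubled_delta_in_out o :
  @delta_in (doubled_net H) (@out (doubled_net H) o) = [set inr o].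
Proof. by apply/setP=> -[[[b a]|i']|o']; rewrite !inE. Qed.

Lemma src_ai i : src (ai i) = inp i.
Proof. by apply/eqP; have := set11 (ai i); rewrite -aiP inE. Qed.

Lemma tgt_ao o : tgt (ao o) = out o.
Proof. by apply/eqP; have := set11 (ao o); rewrite -aoP inE. Qed.

Lemma src_inp (a : arcs H) i : src a = inp i -> a = ai i.
Proof. by move=> E; apply/set1P; rewrite -aiP inE E. Qed.

Lemma tgt_out (a : arcs H) o : tgt a = out o -> a = ao o.
Proof. by move=> E; apply/set1P; rewrite -aoP inE E. Qed.

Lemma tgt_inp (a : arcs H) i : tgt a <> inp i.
Proof.
have /eqP := ((net_terminal_degrees H).1 i).1.
by rewrite cards_eq0 => /eqP/setP/(_ a); rewrite !inE => /eqP.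
Qed.

Lemma src_out (a : arcs H) o : src a <> out o.
Proof.
have /eqP := ((net_terminal_degrees H).2 o).2.
by rewrite cards_eq0 => /eqP/setP/(_ a); rewrite !inE => /eqP.
Qed.

Lemma doubled_src_inp b (a : arcs H) i :
  (doubled_vertex b (src a) == inl (inr (inl (inl i)))) = (a == ai i).
Proof.
apply/eqP/eqP => [|->]; last by rewrite src_ai.
by case E: (src a) => [[i'|?]|?] // [Ei]; apply: src_inp; rewrite E Ei.
Qed.

Lemma doubled_tgt_out b (a : arcs H) o :
  (doubled_vertex b (tgt a) == inl (inr (inl (inr o)))) = (a == ao o).
Proof.
apply/eqP/eqP => [|->]; last by rewrite tgt_ao.
by case E: (tgt a) => [[?|?]|o'] // [Eo]; apply: tgt_out; rewrite E Eo.
Qed.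

Lemma doubled_tgt_inp b (a : arcs H) i :
  (doubled_vertex b (tgt a) == inl (inr (inl (inl i)))) = false.
Proof.
apply/eqP; case E: (tgt a) => [[i'|?]|?] // _.
exact: tgt_inp E.
Qed.

Lemma doubled_src_out b (a : arcs H) o :
  (doubled_vertex b (src a) == inl (inr (inl (inr o)))) = false.
Proof.
apply/eqP; case E: (src a) => [[?|?]|o'] // _.
exact: src_out E.
Qed.

Lemma doubled_vertex_spl b b' (v : vertex H) (s : splitters H) :
  (doubled_vertex b' v == inl (inr (inr (b, s)))) = (b' == b) && (v == spl s).
Proof.
by apply/eqP/andP => [|[/eqP -> /eqP ->] //]; case: v => [[?|s']|?] // [-> ->].
Qed.

Lemma doubled_copy_eq b (a a' : arcs H) :
  (inl (inl (b, a)) == inl (inl (b, a')) :> arcs (doubled_net H)) = (a == a').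
Proof. by apply/eqP/eqP => [[]|->]. Qed.

Lemma flow_doubled t (P : pred (arcs (doubled_net H))) :
  flow (doubled_flow t) [set e | P e] =
  \sum_(b : bool) \sum_(a | P (inl (inl (b, a)))) t a
  + \sum_(i | P (inl (inr i))) t (ai i) *+ 2 + \sum_(o | P (inr o)) t (ao o) *+ 2.
Proof.
rewrite /flow (eq_bigl P) => [|e]; last by rewrite inE.
rewrite !big_sumType /=; congr (_ + _ + _).
by rewrite pair_big_dep; apply: eq_big => [[]|[]].
Qed.

(** Both copies carry the same state, so the paired arcs at a shared vertex have equal flow and
    fairness there is an equality. Halved capacities keep the doubled terminal flows at most 1. *)
Lemma doubled_steady_state (c : inputs H + outputs H -> R) t F :
  (forall v, 0 <= c v <= 1) -> steady_state (fun v => c v / 2) t F ->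
  @steady_state R (doubled_net H) c (doubled_flow t) (doubled_fluid F).
Proof.
move=> c01 [tr tI tO tS fI fO tM].
have tI1 i := tI i _ (aiP i); have tO1 o := tO o _ (aoP o).
split.
- move=> [[[b a]|i]|o] //=.
  + have [h _] := tI1 i; have /andP[t0 _] := tr (ai i); have /andP[_ c1] := c01 (inl i).
    by rewrite mulr2n; lra.
  + have [h _] := tO1 o; have /andP[t0 _] := tr (ao o); have /andP[_ c1] := c01 (inr o).
    by rewrite mulr2n; lra.
- move=> i e; rewrite doubled_delta_out_inp => /set1_inj <-; rewrite inE /=.
  have [h1 h2] := tI1 i; split; first by rewrite mulr2n; lra.
  by move/h2 => ->; rewrite mulr2n -splitr.
- move=> o e; rewrite doubled_delta_in_out => /set1_inj <-; rewrite inE /=.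
  have [h1 h2] := tO1 o; split; first by rewrite mulr2n; lra.
  by move/h2 => ->; rewrite mulr2n -splitr.
- case=> [[i|o]|[b s]]; rewrite !flow_doubled.
  + rewrite [X in X + _ + _ = _]big1 => [|b _]; last first.
      by rewrite big_pred0 // => a; exact: doubled_tgt_inp.
    rewrite (big_pred1 i) => [|i']; last by apply/eqP/eqP => [[]|->].
    rewrite [X in _ = X + _ + _](eq_bigr (fun=> t (ai i))) => [|b _]; last first.
      by apply: big_pred1 => a; exact: doubled_src_inp.
    by rewrite big_bool !big_pred0 // !addr0 add0r mulr2n.
  + rewrite [X in _ = X + _ + _]big1 => [|b _]; last first.
      by rewrite big_pred0 // => a; exact: doubled_src_out.
    rewrite [X in _ = _ + X](big_pred1 o) => [|o']; last by apply/eqP/eqP => [[]|->].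
    rewrite [X in X + _ + _ = _](eq_bigr (fun=> t (ao o))) => [|b _]; last first.
      by apply: big_pred1 => a; exact: doubled_tgt_out.
    by rewrite big_bool !big_pred0 // !addr0 add0r mulr2n.
  + rewrite [X in _ + X + _ = _]big_pred0 // [X in _ = _ + X + _]big_pred0 //.
    rewrite [X in _ + X = _]big_pred0 // [X in _ = _ + X]big_pred0 // !addr0.
    have copyE (g : arcs H -> vertex H) :
        \sum_b' \sum_(a | doubled_vertex b' (g a) == inl (inr (inr (b, s)))) t a =
        \sum_(a | g a == spl s) t a.
      rewrite (bigD1 b) //= [X in _ + X]big1 ?addr0 => [|b' nb].
        by apply: eq_bigl => a; rewrite doubled_vertex_spl eqxx.
      by rewrite big_pred0 // => a; rewrite doubled_vertex_spl (negbTE nb).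
    rewrite !copyE; apply: etrans (etrans (tS s) _); first exact: big_set_pred.
    by rewrite [RHS]big_set_pred.
- move=> s e1 e2 E; have : e1 \in delta_in (spl s) by rewrite E set21.
  have : e2 \in delta_in (spl s) by rewrite E set22.
  rewrite !inE; case: s E => [[i|o]|[b s]] E.
  + case: e1 {E} => [[[b1 a1]|i1]|o1] //; last case: e2 => [[[b2 a2]|i2]|o2] //.
    * by rewrite doubled_tgt_inp.
    * by rewrite doubled_tgt_inp.
    * by move=> /eqP[->] /eqP[->].
  + case: e1 {E} => [[[b1 a1]|i1]|o1] //; case: e2 => [[[b2 a2]|i2]|o2] //.
    by rewrite !doubled_tgt_out => /eqP -> /eqP ->.
  + case: e1 E => [[[b1 a1]|i1]|o1] //; case: e2 => [[[b2 a2]|i2]|o2] //= E.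
    rewrite !doubled_vertex_spl => /andP[/eqP Eb2 _] /andP[/eqP Eb1 _].
    apply: (fI s); apply/setP => a; have /setP/(_ (inl (inl (b, a)))) := E.
    by rewrite !inE doubled_vertex_spl eqxx Eb1 Eb2 !doubled_copy_eq.
- move=> s e1 e2 E; have : e1 \in delta_out (spl s) by rewrite E set21.
  have : e2 \in delta_out (spl s) by rewrite E set22.
  rewrite !inE; case: s E => [[i|o]|[b s]] E.
  + case: e1 {E} => [[[b1 a1]|i1]|o1] //; case: e2 => [[[b2 a2]|i2]|o2] //.
    by rewrite !doubled_src_inp => /eqP -> /eqP ->.
  + case: e1 {E} => [[[b1 a1]|i1]|o1] //; last case: e2 => [[[b2 a2]|i2]|o2] //.
    * by rewrite doubled_src_out.
    * by rewrite doubled_src_out.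
    * by move=> /eqP[->] /eqP[->].
  + case: e1 E => [[[b1 a1]|i1]|o1] //; case: e2 => [[[b2 a2]|i2]|o2] //= E.
    rewrite !doubled_vertex_spl => /andP[/eqP Eb2 _] /andP[/eqP Eb1 _].
    apply: (fO s); apply/setP => a; have /setP/(_ (inl (inl (b, a)))) := E.
    by rewrite !inE doubled_vertex_spl eqxx Eb1 Eb2 !doubled_copy_eq.
- move=> [[[b a]|i]|o] [[[b' a']|i']|o'] //=; rewrite !inE /=.
  (* Forgetting the copy index, consecutive arcs remain consecutive in [H]. *)
  + move=> E; apply: tM; move: E.
    by case: (tgt a) (src a') => [[?|?]|?] [[?|?]|?] //= []; congruence.
  + by move/eqP; rewrite doubled_tgt_out => /eqP -> /negP.
  + by move/esym/eqP; rewrite doubled_src_inp => /eqP -> /negP.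
Qed.

End Doubling.
End Networks.

(** * Choosing the common cap by the intermediate value theorem *)

Lemma water_filling (R : realType) (I : finType) (c : I -> R) (m s : R) :
  (forall i, 0 <= c i <= m) -> 0 <= m -> 0 <= s <= \sum_i c i ->
  exists2 b, 0 <= b <= m & \sum_i Num.min (c i) b = s.
Proof.
move=> cm m0 sc; pose f x := \sum_i Num.min (c i) x.
have f0 : f 0 = 0 by apply: big1 => i _; case/andP: (cm i) => *; exact/min_idPr.
have fm : f m = \sum_i c i.
  by apply: eq_bigr => i _; case/andP: (cm i) => *; exact/min_idPl.
have [||b] := @IVT R f 0 m s m0; last by rewrite in_itv; exists b.
- apply: continuous_subspaceT.
  apply: continuous_big => [|i _ x]; first exact: add_continuous.
  by apply: continuous_min; [exact: cvg_cst|exact: cvg_id].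
- by rewrite f0 fm; case/andP: sc => s0 sc; rewrite min_l ?max_r ?s0 // (le_trans s0).
Qed.

(** * Averaging loads along the Beneš levels *)

Section Mixing.
Variables (R : realType) (k : nat).
Implicit Types (j : 'I_(2 ^ k)) (l : nat).

Lemma expn_pow n : (2 ^ n)%N = Nat.pow 2 n.
Proof. by elim: n => //= n <-; rewrite expnS; lia. Qed.

Lemma testbit_ge j n : (k <= n)%N -> Nat.testbit j n = false.
Proof.
move=> kn; rewrite -[nat_of_ord j](@PeanoNat.Nat.mod_small j (Nat.pow 2 k)).
  by apply: PeanoNat.Nat.mod_pow2_bits_high; lia.
by rewrite -expn_pow; apply/ssrnat.ltP.
Qed.

(** Total in [l], so that [load] can recurse on a plain natural number; beyond the network the mask
    defaults to 0. *)
Definition benes_mask l : 'I_(2 ^ k) :=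
  insubd (Ordinal (expn_gt0 2 k)) (2 ^ benes_bit k.+1 l)%N.

Lemma benes_maskE (l : 'I_(k.+1.*2.-2)) :
  Ordinal (benes_bit_subproof l) = benes_mask l.
Proof.
by apply: val_inj; rewrite /= val_insubd (benes_bit_subproof l).
Qed.

Fixpoint load (T : 'I_(2 ^ k) -> R) l : 'I_(2 ^ k) -> R :=
  if l is l'.+1 then
    fun j => (load T l' j + load T l' (xor_ord j (benes_mask l'))) / 2
  else T.

Lemma load_range (T : 'I_(2 ^ k) -> R) m l j :
  (forall j, 0 <= T j <= m) -> 0 <= load T l j <= m.
Proof.
move=> Tm; elim: l j => [//|l IH] j /=.
by have := IH j; have := IH (xor_ord j (benes_mask l)); lra.
Qed.

Lemma sum_load (T : 'I_(2 ^ k) -> R) l : \sum_j load T l j = \sum_j T j.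
Proof.
elim: l => //= l IH; rewrite -mulr_suml big_split /=.
have -> : \sum_j load T l (xor_ord j (benes_mask l)) = \sum_j load T l j.
  by rewrite [RHS](reindex_inj (inv_inj (xor_ordK (benes_mask l)))).
by rewrite IH mulrDl -splitr.
Qed.

(** Each of the first [k] levels averages over the highest bit the load still depends on, and
    thereby erases it. *)
Lemma load_low_bits (T : 'I_(2 ^ k) -> R) l j j' : (l <= k)%N ->
  (forall n, (n < k - l)%N -> Nat.testbit j n = Nat.testbit j' n) ->
  load T l j = load T l j'.
Proof.
elim: l j j' => [|l IH] j j' lk jj'.
  congr T; apply/val_inj/PeanoNat.Nat.bits_inj => n.
  by have [nk|kn] := ltnP n k; [apply: jj'; rewrite subn0|rewrite !testbit_ge].
have bE : benes_bit k.+1 l = (k - l.+1)%N by rewrite /benes_bit; lia.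
have mE : benes_mask l = Nat.pow 2 (k - l.+1) :> nat.
  have ll : (l < k.+1.*2.-2)%N by lia.
  by rewrite -(benes_maskE (Ordinal ll)) /= bE expn_pow.
have xE (i : 'I_(2 ^ k)) n : Nat.testbit (xor_ord i (benes_mask l)) n =
    xorb (Nat.testbit i n) (n == k - l.+1)%N.
  rewrite /= PeanoNat.Nat.lxor_spec mE PeanoNat.Nat.pow2_bits_eqb; congr xorb.
  by rewrite eq_sym; apply/idP/eqP => /PeanoNat.Nat.eqb_eq.
have low (i i' : 'I_(2 ^ k)) :
    (forall n, (n < k - l.+1)%N -> Nat.testbit i n = Nat.testbit i' n) ->
    Nat.testbit i (k - l.+1) = Nat.testbit i' (k - l.+1) ->
    load T l i = load T l i'.
  move=> ii' ib; apply: IH => [|n nl]; first exact: ltnW.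
  have [->//|nb] := eqVneq n (k - l.+1)%N; apply: ii'; lia.
rewrite /=; congr (_ / 2).
have [b|b] := eqVneq (Nat.testbit j (k - l.+1)) (Nat.testbit j' (k - l.+1)).
  by congr (_ + _); apply: low => // [n nl|]; rewrite !xE ?b // jj' //; lia.
(* When the averaged bits differ, each index matches the other's xor partner, so the two summands
   agree crosswise. *)
rewrite addrC; congr (_ + _); apply: low => [n nl|]; rewrite xE ?eqxx.
- by rewrite jj' ?(ltn_eqF nl) ?Bool.xorb_false_r //; lia.
- by move: b; do 2 case: Nat.testbit.
- by rewrite jj' ?(ltn_eqF nl) ?Bool.xorb_false_r //; lia.
- by move: b; do 2 case: Nat.testbit.
Qed.

(** After [k] levels no bit remains, so the load is constant and equals the mean; further averaging
    preserves a constant. *)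
Lemma load_uniform (T : 'I_(2 ^ k) -> R) m l j : (k <= l)%N ->
  \sum_j T j = m *+ 2 ^ k -> load T l j = m.
Proof.
move=> kl Tm.
have loadk i : load T k i = m.
  have /eqP := sum_load T k; rewrite Tm.
  rewrite (eq_bigr (fun=> load T k i)) => [|i' _]; last first.
    by apply: load_low_bits => // n; rewrite subnn.
  by rewrite sumr_const card_ord eqrMn2r -leqn0 leqNgt expn_gt0 => /eqP.
elim: l kl j => [|l IH]; first by rewrite leqn0 => /eqP k0 j; rewrite -(loadk j) k0.
rewrite leq_eqVlt => /orP[/eqP <- //|]; rewrite ltnS => kl j.
by rewrite /= !IH // mulrDl -splitr.
Qed.

End Mixing.

(** * The half-universal network and its self-duality *)

Section HalfUniversal.
Variables (R : realType) (k : nat).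
Local Notation H := (half_universal_net k).

Definition half_arc_benes (a : benes_arc k.+1) : arcs H := inl (inl (inl a)).
Definition half_arc_inp (j : 'I_(2 ^ k)) : arcs H := inl (inl (inr j)).
Definition half_arc_out (j : 'I_(2 ^ k)) : arcs H := inl (inr j).
Definition half_arc_back (j : 'I_(2 ^ k)) : arcs H := inr j.

Lemma half_delta_out_inp j : delta_out (@inp H j) = [set half_arc_inp j].
Proof. by apply/setP=> -[[[a|i]|i]|i]; rewrite !inE. Qed.

Lemma half_delta_in_out j : delta_in (@out H j) = [set half_arc_out j].
Proof. by apply/setP=> -[[[a|i]|i]|i]; rewrite !inE. Qed.

Lemma half_last_level (l : 'I_(k.+1.*2.-1)) j :
  ~~ (l < k.+1.*2.-2)%N -> (l, j) = last_level j.
Proof.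
rewrite -leqNgt => kl; congr pair; apply/val_inj/eqP.
by rewrite eqn_leq kl -ltnS ltn_ord.
Qed.

Lemma flow_half_out t l j :
  flow t (delta_out (@spl H (l, j))) =
  if insub (val l) is Some l' then
    t (half_arc_benes (l', j, false)) + t (half_arc_benes (l', j, true)) : R
  else t (half_arc_out j) + t (half_arc_back j).
Proof.
case: insubP => [l' _ ll'|kl]; apply: flow2; rewrite ?half_universal_out_degree //.
- by rewrite inE; apply/eqP; congr (inl (inr (_, _))); apply: val_inj.
- by rewrite inE; apply/eqP; congr (inl (inr (_, _))); apply: val_inj.
- by apply/eqP.
- by rewrite inE (half_last_level j kl).
- by rewrite inE (half_last_level j kl).
Qed.

Lemma flow_half_in0 t j :
  flow t (delta_in (@spl H (first_level j))) =
  t (half_arc_inp j) + t (half_arc_back j) :> R.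
Proof. by apply: flow2; rewrite ?half_universal_in_degree ?inE. Qed.

Lemma flow_half_inS t (l : 'I_(k.+1.*2.-2)) j :
  flow t (delta_in (@spl H (Ordinal (benes_tgt_subproof l), j))) =
  t (half_arc_benes (l, j, false))
  + t (half_arc_benes (l, xor_ord j (Ordinal (benes_bit_subproof l)), true)) :> R.
Proof.
apply: flow2; rewrite ?half_universal_in_degree ?inE //=; last by apply/eqP.
by rewrite xor_ordK.
Qed.

Definition half_rev_vertex (v : vertex H) : vertex H :=
  match v with
  | inl (inl i) => inr i
  | inl (inr (l, j)) => inl (inr (rev_ord l, j))
  | inr o => inl (inl o)
  end.

(** A reversed Beneš arc starts in the old target column; since levels [l] and [2k - 1 - l] use the
    same mask, the same crossing flag leads back. *)
Definition half_rev_arc (e : arcs H) : arcs H :=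
  match e with
  | inl (inl (inl a)) => inl (inl (inl (rev_ord a.1.1, (benes_tgt a).2, a.2)))
  | inl (inl (inr j)) => inl (inr j)
  | inl (inr j) => inl (inl (inr j))
  | inr j => inr j
  end.

Lemma benes_bit_rev (l : 'I_(k.+1.*2.-2)) :
  benes_bit k.+1 (rev_ord l) = benes_bit k.+1 l.
Proof.
have -> : rev_ord l = (k.+1.*2.-2 - l.+1)%N :> nat by [].
by rewrite /benes_bit; have := ltn_ord l; lia.
Qed.

Lemma benes_mask_rev (l : 'I_(k.+1.*2.-2)) :
  Ordinal (benes_bit_subproof (rev_ord l)) = Ordinal (benes_bit_subproof l).
Proof. by apply: val_inj => /=; rewrite benes_bit_rev. Qed.

Lemma half_rev_vertexK : involutive half_rev_vertex.
Proof. by move=> [[i|[l j]]|o] //=; rewrite rev_ordK. Qed.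

Lemma half_rev_arcK : involutive half_rev_arc.
Proof.
move=> [[[[[l j] []]|i]|i]|i] //=; rewrite ?rev_ordK ?benes_mask_rev //.
by rewrite xor_ordK.
Qed.

Lemma src_half_rev e : src (half_rev_arc e) = half_rev_vertex (tgt e).
Proof.
case: e => [[[[[l j] b]|i]|i]|i] //=.
- congr (inl (inr (_, _))); apply: val_inj.
  change (k.+1.*2.-2 - l.+1 = k.+1.*2.-1 - l.+2)%N; lia.
- by congr (inl (inr (_, _))); apply: val_inj; rewrite /= subn1.
- by congr (inl (inr (_, _))); apply: val_inj; rewrite /= subn1.
Qed.

Lemma tgt_half_rev e : tgt (half_rev_arc e) = half_rev_vertex (src e).
Proof. by rewrite -[e in RHS]half_rev_arcK src_half_rev half_rev_vertexK. Qed.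

(** * Explicit steady state when supply does not exceed demand *)

Variable c : 'I_(2 ^ k) + 'I_(2 ^ k) -> R.
Hypothesis c_range : forall v, 0 <= c v <= 1 / 2.

Section Surplus.
Variable b : R.
Hypothesis b_range : 0 <= b <= 1 / 2.
Hypothesis b_balance : \sum_j Num.min (c (inr j)) b = \sum_j c (inl j).

(* Each last-level splitter receives 2 b; what its output refuses goes back. *)
Definition half_back j : R := b *+ 2 - Num.min (c (inr j)) b.

Definition half_load := load (fun j => c (inl j) + half_back j).

Definition half_flow (e : arcs H) : R :=
  match e with
  | inl (inl (inl (l, j, _))) => half_load l j / 2
  | inl (inl (inr j)) => c (inl j)
  | inl (inr j) => Num.min (c (inr j)) b
  | inr j => half_back j
  end.

Definition half_fluid : {set arcs H} :=
  ~: [set half_arc_out j | j in [pred j | c (inr j) < b]].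

(** This closes the feedback loop: by [b_balance], inputs replace exactly what outputs remove, so
    the entering total is [2b] per column. *)
Lemma half_load_last l j : (k <= l)%N -> half_load l j = b *+ 2.
Proof.
move=> kl; apply: load_uniform => //.
rewrite big_split sumrB /= b_balance addrC subrK sumr_const card_ord //.
Qed.

Lemma half_load_range l j : 0 <= half_load l j <= 3 / 2.
Proof.
apply: load_range => i; rewrite /half_back (mulr2n b).
have := b_range; have := c_range (inl i); have := c_range (inr i).
by case: (ltP (c (inr i)) b) => ?; lra.
Qed.

Lemma half_out_fluid j : (half_arc_out j \in half_fluid) = (b <= c (inr j)).
Proof.
rewrite inE mem_imset ?inE -?leNgt // => i i' [].
exact.
Qed.

Lemma half_saturated e : e \notin half_fluid ->
  exists2 j, e = half_arc_out j & c (inr j) < b.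
Proof. by rewrite inE negbK => /imsetP[j]; exists j. Qed.

Lemma half_surplus_steady_state : @steady_state R H c half_flow half_fluid.
Proof.
split.
- move=> [[[[[l j] x]|j]|j]|j] /=.
  + by have := half_load_range l j; lra.
  + by have := c_range (inl j); lra.
  + have := b_range; have := c_range (inr j).
    by case: (ltP (c (inr j)) b) => ?; lra.
  + have := b_range; have := c_range (inr j).
    by rewrite /half_back (mulr2n b); case: (ltP (c (inr j)) b) => ?; lra.
- by move=> j e; rewrite half_delta_out_inp => /set1_inj <-; split.
- move=> j e; rewrite half_delta_in_out => /set1_inj <-; rewrite half_out_fluid -ltNge /=.
  by split => [|cb]; [rewrite ge_min lexx|rewrite min_l // ltW].
- move=> [l j]; have outE : flow half_flow (delta_out (@spl H (l, j))) = half_load l j.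
    rewrite flow_half_out; case: insubP => [l' _ ll'|kl] /=.
      by rewrite ll' -splitr.
    have kl' : (k <= l)%N by move: kl; rewrite -leqNgt; apply: leq_trans; lia.
    by rewrite half_load_last // /half_back addrC subrK.
  rewrite outE; have [l0|l0] := posnP l.
    have -> : (l, j) = first_level j by congr pair; apply: val_inj.
    by rewrite flow_half_in0 /= l0.
  have lk : (l.-1 < k.+1.*2.-2)%N by have := ltn_ord l; lia.
  have -> : l = Ordinal (benes_tgt_subproof (Ordinal lk)).
    by apply: val_inj; rewrite /= prednK.
  by rewrite flow_half_inS /half_load /= (benes_maskE (Ordinal lk)) mulrDl.
(* Saturated arcs enter only outputs, so none enters a splitter. *)
- move=> s e1 e2 E /half_saturated[j e1E _].
  by have /setP/(_ e1) := E; rewrite e1E !inE eqxx.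
- move=> s e1 e2 E Fe1; have : e1 \in delta_out (spl s) by rewrite E set21.
  have : e2 \in delta_out (spl s) by rewrite E set22.
  case: s {E} => l j; rewrite !inE.
  case: e1 Fe1 => [[[[[l1 j1] x1]|j1]|j1]|j1] Fe1 //;
    case: e2 => [[[[[l2 j2] x2]|j2]|j2]|j2] //=.
  + by move=> /eqP[<- ->] /eqP[-> ->].
  + by move=> /eqP[<- _] /eqP[E1 _]; have := ltn_ord l1; rewrite E1 ltnn.
  + by move=> /eqP[<- _] /eqP[E1 _]; have := ltn_ord l1; rewrite E1 ltnn.
  + by move=> /eqP[<- _] /eqP[E2 _]; have := ltn_ord l2; rewrite -E2 ltnn.
  + by move=> /eqP[_ ->] /eqP[_ ->].
  (* A fluid output arc takes [b], leaving exactly [b] for the back arc. *)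
  + have bc : b <= c (inr j1) by rewrite -half_out_fluid.
    move=> /eqP[_ ->] /eqP[_ Ej]; rewrite Ej in bc *.
    by rewrite /half_back (mulr2n b) min_r //; lra.
  + by move=> /eqP[<- _] /eqP[E2 _]; have := ltn_ord l2; rewrite -E2 ltnn.
  (* The output arc takes at most [b], hence the back arc at least [b]. *)
  + move=> /eqP[_ ->] /eqP[_ ->]; rewrite /half_back (mulr2n b).
    by case: (ltP (c (inr j)) b) => ?; lra.
  + by move=> /eqP[_ ->] /eqP[_ ->].
- move=> e f ef /half_saturated[j ej _] _; move: ef; rewrite ej /=.
  by case: f => [[[a|?]|?]|?].
Qed.

End Surplus.

(** Both the entering and the leaving totals are recorded because reversal exchanges them. *)
Lemma half_surplus_balancing : \sum_j c (inl j) <= \sum_j c (inr j) ->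
  exists (t : arcs H -> R) F a b,
    [/\ @steady_state R H c t F, 0 <= a /\ 0 <= b,
        forall j, t (half_arc_inp j) = Num.min (c (inl j)) a,
        forall j, t (half_arc_out j) = Num.min (c (inr j)) b
      & \sum_j t (half_arc_inp j) = \sum_j c (inl j) /\
        \sum_j t (half_arc_out j) = \sum_j c (inl j)].
Proof.
move=> cc; have [j|||b b2 bE] :=
  @water_filling R _ (fun j => c (inr j)) (1 / 2) (\sum_j c (inl j)).
- exact: c_range.
- by lra.
- by rewrite cc sumr_ge0 // => i _; case/andP: (c_range (inl i)).
(* The bound 1/2 dominates every capacity, so the input cap is inactive. *)
exists (half_flow b), (half_fluid b), (1 / 2), b; split=> //.
- exact: half_surplus_steady_state.
- by split; [lra|case/andP: b2].
- by move=> j /=; rewrite min_l //; case/andP: (c_range (inl j)).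
Qed.

End HalfUniversal.

(** * Both regimes, and assembly of the universal network *)

Lemma half_universal_balancing (R : realType) (k : nat)
    (c : 'I_(2 ^ k) + 'I_(2 ^ k) -> R) :
  (forall v, 0 <= c v <= 1 / 2) ->
  exists (t : arcs (half_universal_net k) -> R) F a b,
    [/\ @steady_state R (half_universal_net k) c t F, 0 <= a /\ 0 <= b,
        forall j, t (half_arc_inp j) = Num.min (c (inl j)) a,
        forall j, t (half_arc_out j) = Num.min (c (inr j)) b
      & \sum_j t (half_arc_inp j) = Num.min (\sum_j c (inl j)) (\sum_j c (inr j))].
Proof.
move=> c2; have [cc|cc] := leP (\sum_j c (inl j)) (\sum_j c (inr j)).
  have [t [F [a [b [st ab ta tb [tI _]]]]]] := half_surplus_balancing c2 cc.
  by exists t, F, a, b.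
(* Excess supply: solve the dual problem and reverse it, which also swaps the two caps. *)
pose c' v := match v with inl i => c (inr i) | inr o => c (inl o) end.
have [|t [F [a [b [st [a0 b0] ta tb [_ tO]]]]]] :=
  @half_surplus_balancing R k c' _ (ltW cc).
  by case=> j; exact: c2.
exists (t \o @half_rev_arc k), (~: (@half_rev_arc k @^-1: F)), b, a; split=> //.
apply: (@steady_state_reversal R (half_universal_net k)
  (@half_rev_vertex k) (@half_rev_arc k) id id (fun s => (rev_ord s.1, s.2))
  (@half_rev_vertexK k) (@half_rev_arcK k)) => //.
- by case.
- exact: src_half_rev.
- exact: tgt_half_rev.
Qed.

Theorem theorem6 (R : realType) (k : nat) (hk : (1 <= k)%N) :
  universally_balancing R (universal_network k).
Proof.
move=> c c01.
have [|t [F [a [b [st [a0 b0] ta tb tI]]]]] :=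
  @half_universal_balancing R k (fun v => c v / 2).
  by move=> v; have := c01 v; lra.
pose t' := doubled_flow (H := half_universal k) (@half_arc_inp k) (@half_arc_out k) t.
(* Doubling undoes the halving of capacities and doubles the caps. *)
have min2 x y : Num.min (x / 2) y *+ 2 = Num.min x (y *+ 2) :> R.
  by rewrite mulr2n; case: (ltP (x / 2) y) => ?; case: (ltP x (y *+ 2)) => ?; lra.
have tE i : flow (complete_flow t') (@delta_out (complete (universal_network k))
    (complete_vertex (inp i))) = t (half_arc_inp i) *+ 2.
  by rewrite flow_complete_out doubled_delta_out_inp flow1.
exists (complete_flow t').
exists (complete_fluid (doubled_fluid (H := half_universal k)
  (@half_arc_inp k) (@half_arc_out k) F)), (a *+ 2), (b *+ 2); split.
- apply: complete_steady_state; apply: doubled_steady_state => //.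
  + exact: half_delta_out_inp.
  + exact: half_delta_in_out.
- by rewrite !mulrn_wge0.
- by move=> i; rewrite tE ta min2.
- move=> o; rewrite -min2 -tb.
  by rewrite flow_complete_in doubled_delta_in_out flow1.
- rewrite flow_bigcup_delta_out => [|i i' E]; last by case: E.
  rewrite (eq_bigr _ (fun i _ => tE i)) sumrMnl tI -!mulr_suml mulr2n.
  by do 2 case: ltP => ?; lra.
Qed.
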